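(* For every integer $n\ge 4$, $$\beta_b(\overrightarrow{C}(n;1,3)) = \beta_b(\overrightarrow{C}(n;1,-(n-3))) = \left\lfloor\frac{n}{2}\right\rfloor.$$
   Context: For integers $n\ge 3$ and $b_1,\dots,b_k$, the oriented circulant graph $\overrightarrow{C}(n;b_1,\dots,b_k)$ has vertex set $\{v_0,\dots,v_{n-1}\}$ and arc set $\{v_iv_{i+b_j} : 0\le i\le n-1,\ 1\le j\le k\}$, with subscripts taken modulo $n$ (negative $b_j$ allowed). $d(u,v)$ is the length of a shortest directed path from $u$ to $v$; $e(v)=\max_u d(v,u)$ is the eccentricity; $\mathrm{diam}$ is the maximum eccentricity. An independent broadcast on an oriented graph $\overrightarrow{G}$ is a function $f:V(\overrightarrow{G})\to\{0,\dots,\mathrm{diam}(\overrightarrow{G})\}$ with $f(v)\le e(v)$ for all $v$, and $d(u,v)>f(u)$ for all distinct $u,v$ with $f(u),f(v)>0$. Its cost is $\sigma(f)=\sum_v f(v)$, and $\beta_b(\overrightarrow{G})$ is the maximum cost of an independent broadcast on $\overrightarrow{G}$. *)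

(* Defs.v *)
From mathcomp Require Import all_boot all_order all_algebra.

Set Implicit Arguments.
Unset Strict Implicit.
Unset Printing Implicit Defensive.

Section Digraph.

Variables (T : finType) (e : rel T).

(* u :: p lists the vertices of a directed path from u to v without repeated
   vertices; its length (number of arcs) is [size p]. *)
Definition dipath (u v : T) (p : seq T) : bool :=
  [&& path e u p, last u p == v & uniq (u :: p)].

(* Length of a shortest directed path. The search range contains all possible
   lengths, since a path has fewer than #|T| arcs; #|T| is the conventional
   value when v is not reachable from u. *)
Definition dist (u v : T) : nat :=
  find (fun k => [exists p : k.-tuple T, dipath u v p]) (iota 0 #|T|).

Definition ecc (v : T) : nat := \max_(u : T) dist v u.

Definition diam : nat := \max_(v : T) ecc v.

Definition indep_broadcast (f : {ffun T -> 'I_diam.+1}) : bool :=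
  [forall v, f v <= ecc v] &&
  [forall u, forall v, [&& u != v, 0 < f u & 0 < f v] ==> (f u < dist u v)].

Definition cost (f : {ffun T -> 'I_diam.+1}) : nat := \sum_(v : T) f v.

(* The zero function is an independent broadcast, so this is the maximum over
   a nonempty finite set. *)
Definition beta_b : nat := \max_(f | indep_broadcast f) cost f.

Lemma dipath_size u v p : dipath u v p -> size p < #|T|.
Proof.
by case/and3P=> _ _ U; have := max_card (mem (u :: p)); rewrite (card_uniqP U).
Qed.

Lemma dist_min u v p : dipath u v p -> dist u v <= size p.
Proof.
move=> up; have sp := dipath_size up.
rewrite leqNgt; apply/negP=> /(before_find 0).
rewrite nth_iota // add0n => /negbT/existsPn/(_ (in_tuple p)).
by rewrite up.
Qed.

Lemma dist_attained u v :
  connect e u v -> exists2 p, dipath u v p & size p = dist u v.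
Proof.
case/connectP=> p0 /shortenP[p ep U _] vE.
have up : dipath u v p by rewrite /dipath ep U vE eqxx.
have lt : dist u v < #|T|.
  exact: leq_ltn_trans (dist_min up) (dipath_size up).
have hs : has (fun k => [exists p : k.-tuple T, dipath u v p]) (iota 0 #|T|).
  by rewrite has_find size_iota.
have := nth_find 0 hs; rewrite -/(dist u v) nth_iota // add0n.
by case/existsP=> q uq; exists q => //; rewrite size_tuple.
Qed.

End Digraph.

Definition circulant (n : nat) (bs : seq int) : rel 'I_n :=
  fun i j => has (fun b : int => (j%:Z == i%:Z + b %[mod n])%Z) bs.

Arguments circulant : clear implicits.

(* Main.v *)
Require Import Defs.
From mathcomp Require Import all_boot all_order all_algebra.
From mathcomp Require Import zify.

(** Write D(u,v) = v - u mod n. Walking from u with steps 3 first and then 1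
    shows d(u,v) <= q + r when D(u,v) = 3q + r, r < 3. If u <> v both carry a
    positive value, then f(u) <= q + r - 1, and this is at most D(u,v) / 2.
    Hence the cyclic intervals [u, u + 2 f(u)), which have at most n elements
    since the diameter is at most n / 2, are pairwise disjoint, so
    2 cost(f) <= n. For equality, take the indicator of the odd vertices when n
    is even, and when n is odd the value 2 at 0 and 1 at 5, 7, ..., n - 2. *)

Set Implicit Arguments.
Unset Strict Implicit.
Unset Printing Implicit Defensive.

Section Dist.

Variables (T : finType) (e : rel T).

Lemma dist_le_walk u p : path e u p -> dist e u (last u p) <= size p.
Proof.
case/shortenP=> q eq uq sqp.
apply: leq_trans (dist_min (p := q) _) _; first by rewrite /dipath eq uq eqxx.
by case/andP: uq => _ uq; apply: uniq_leq_size.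
Qed.

Lemma dist_gt1 u v : connect e u v -> u != v -> ~~ e u v -> 1 < dist e u v.
Proof.
move=> /dist_attained[p] /and3P[ep /eqP lp _] <-.
case: p ep lp => [|a [|b p]] //= => [_ ->|]; first by rewrite eqxx.
by rewrite andbT => ea <-; rewrite ea.
Qed.

Lemma dist_gt2 u v : connect e u v -> u != v -> ~~ e u v ->
  (forall w, e u w -> ~~ e w v) -> 2 < dist e u v.
Proof.
move=> /dist_attained[p] /and3P[ep /eqP lp _] <-.
case: p ep lp => [|a [|b [|c p]]] //= => [_ ->||]; first by rewrite eqxx.
  by rewrite andbT => ea <-; rewrite ea.
by rewrite andbT => /andP[ea eb] <- _ _ /(_ a ea); rewrite eb.
Qed.

Lemma dist_le_ecc u v : dist e u v <= ecc e u.
Proof. by rewrite /ecc (bigD1 v) //= leq_maxl. Qed.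

Lemma ecc_le_diam u : ecc e u <= diam e.
Proof. by rewrite /diam (bigD1 u) //= leq_maxl. Qed.

End Dist.

(** The difference D of the overview, written by cases in [nat] rather than with [%%] so that goals
    about it are linear and fall to [lia]. *)
Definition cycdiff n (i j : 'I_n) : nat := if i <= j then j - i else n + j - i.

Lemma cycdiffP n (u v : 'I_n) :
  u < n /\ v < n /\ cycdiff u v < n /\
  (u + cycdiff u v = v \/ u + cycdiff u v = v + n).
Proof.
rewrite /cycdiff; have := ltn_ord u; have := ltn_ord v => vn un.
by case: (leqP u v); lia.
Qed.

Lemma cycdiff_eq0 n (u v : 'I_n) : (cycdiff u v == 0) = (u == v).
Proof. by rewrite -val_eqE /=; have := cycdiffP u v; lia. Qed.

Lemma cycdiff_sub n (u v w : 'I_n) :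
  cycdiff u w <= cycdiff u v -> cycdiff w v = cycdiff u v - cycdiff u w.
Proof. by have := cycdiffP u v; have := cycdiffP u w; have := cycdiffP w v; lia. Qed.

Definition cycshift n (u : 'I_n) k : 'I_n := insubd u ((u + k) %% n).

Lemma cycdiff_shift n (u : 'I_n) k : k < n -> cycdiff u (cycshift u k) = k.
Proof.
move=> kn; have := cycdiffP u (cycshift u k).
rewrite [\val (cycshift u k)]val_insubd ltn_pmod; last by lia.
have [ukn|ukn] := ltnP (u + k) n; first by rewrite modn_small //; lia.
have -> : (u + k) %% n = u + k - n.
  by rewrite -{1}(subnK ukn) modnDr modn_small //; have := ltn_ord u; lia.
by lia.
Qed.

(** The shifts of [u] by k < m inject ['I_m] into the interval; [m <= n] keeps them from wrapping
    onto each other. *)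
Lemma card_cycdiff_lt n (u : 'I_n) m :
  m <= n -> m <= #|[set w : 'I_n | cycdiff u w < m]|.
Proof.
move=> mn; pose h (k : 'I_m) := cycshift u k.
have hK k : cycdiff u (h k) = k.
  by apply: cycdiff_shift; apply: leq_trans (ltn_ord k) mn.
have h_inj : injective h.
  by move=> k l hkl; apply: ord_inj; rewrite -(hK k) hkl hK.
rewrite -[X in X <= _](card_ord m) -cardsT -(card_imset _ h_inj).
by apply/subset_leq_card/subsetP=> _ /imsetP[k _ ->]; rewrite inE hK.
Qed.

Section Circulant13.

Variables (n : nat) (e : rel 'I_n).
Hypothesis n_ge4 : 4 <= n.
(** Both graphs of the theorem satisfy this, as -(n - 3) is 3 modulo n. *)
Hypothesis eE : forall i j, e i j = (cycdiff i j == 1) || (cycdiff i j == 3).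

Lemma walk13 q r (u v : 'I_n) : cycdiff u v = 3 * q + r ->
  exists p, [/\ path e u p, last u p = v & size p = q + r].
Proof.
(* An arc that does not overshoot [v] lowers the remaining difference by exactly its length. *)
have step c w : c = 1 \/ c = 3 -> c <= cycdiff w v ->
    e w (cycshift w c) /\ cycdiff (cycshift w c) v = cycdiff w v - c.
  move=> c13 cv; have wc : cycdiff w (cycshift w c) = c.
    by apply: cycdiff_shift; lia.
  by rewrite eE wc (@cycdiff_sub _ w) wc //; split=> //; lia.
elim: q u => [|q IHq] u; last first.
  move=> uv; have [||ew wv] := step 3 u; [by right | lia |].
  have [|p [ep lp sp]] := IHq (cycshift u 3); first by lia.
  by exists (cycshift u 3 :: p); rewrite /= ew ep lp sp.
elim: r u => [|r IHr] u uv.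
  by exists [::]; split=> //=; apply/eqP; rewrite -cycdiff_eq0 uv.
have [||ew wv] := step 1 u; [by left | lia |].
have [|p [ep lp sp]] := IHr (cycshift u 1); first by lia.
by exists (cycshift u 1 :: p); rewrite /= ew ep lp sp.
Qed.

Lemma dist13_le u v : dist e u v <= cycdiff u v %/ 3 + cycdiff u v %% 3.
Proof.
have [|p [ep <- <-]] := @walk13 (cycdiff u v %/ 3) (cycdiff u v %% 3) u v.
  by rewrite mulnC -divn_eq.
exact: dist_le_walk.
Qed.

Lemma connect13 u v : connect e u v.
Proof.
have [|p [ep lp _]] := @walk13 0 (cycdiff u v) u v; first by [].
by apply/connectP; exists p.
Qed.

(** For D = 3q + r < n, 2(q + r) <= D + 1 <= n unless D = 2, the case settled by n >= 4. *)
Lemma ecc13_le u : 2 * ecc e u <= n.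
Proof.
suff: ecc e u <= n %/ 2 by lia.
apply/bigmax_leqP=> v _; apply: leq_trans (dist13_le u v) _.
by have := cycdiffP u v; lia.
Qed.

(** Makes the value 2 of [optval] admissible. *)
Lemma ecc13_ge2 u : 2 <= ecc e u.
Proof.
have uv : cycdiff u (cycshift u 2) = 2 by apply: cycdiff_shift; lia.
apply: leq_trans (dist_le_ecc e u (cycshift u 2)).
by apply: dist_gt1 (connect13 _ _) _ _; rewrite -?cycdiff_eq0 ?eE uv.
Qed.

Lemma cost13_le f : indep_broadcast (e := e) f -> cost f <= n %/ 2.
Proof.
case/andP=> /forallP fecc /forallP find.
have fn v : 2 * f v <= n by have := ecc13_le v; have := fecc v; lia.
(* 2(q + r - 1) <= 3q + r because r <= 2. *)
have sep u v : u != v -> 0 < f u -> 0 < f v -> 2 * f u <= cycdiff u v.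
  move=> uv fu fv; have := dist13_le u v.
  by have /forallP/(_ v)/implyP := find u; rewrite uv fu fv => /(_ isT); lia.
suff: 2 * cost f <= n by lia.
rewrite /cost big_distrr /= -[X in _ <= X](card_ord n) -sum1_card.
have le1 : \sum_v 2 * f v <= \sum_v \sum_w (cycdiff v w < 2 * f v : nat).
  apply: leq_sum => v _; apply: leq_trans (card_cycdiff_lt v (fn v)) _.
  by rewrite -sum1dep_card big_mkcond /=.
apply: leq_trans le1 _; rewrite exchange_big /=; apply: leq_sum => w _.
have -> : \sum_v (cycdiff v w < 2 * f v : nat) = #|[set v | cycdiff v w < 2 * f v]|.
  by rewrite -sum1dep_card [RHS]big_mkcond.
(* If w = u + a = v + b lies in both intervals and a >= b, then D(u,v) = a - b < 2 f(u), against
   [sep]; the case a < b is symmetric. *)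
apply/card_le1_eqP=> u v; rewrite !inE => uw vw; apply/eqP/negPn/negP=> uv.
have fu : 0 < f u by lia.
have fv : 0 < f v by lia.
have := sep v u uv fv fu; have := sep u v; rewrite eq_sym uv => /(_ isT fu fv).
have := cycdiffP u w; have := cycdiffP v w.
by have := cycdiffP u v; have := cycdiffP v u; lia.
Qed.

(** For odd n the odd vertices alone fail, since n - 2 has an arc of length 3 to 1; so 1 and 3 are
    traded for the value 2 at 0. *)
Definition optval (v : 'I_n) : nat :=
  if odd n then (if v == 0 :> nat then 2 else odd v && (5 <= v)) else odd v.

Lemma sum_odd m : \sum_(i < m) (odd i : nat) = m %/ 2.
Proof.
by elim: m => [|m IHm]; rewrite ?big_ord0 // big_ord_recr /= IHm; lia.
Qed.

Lemma sum_odd_ge5 m : \sum_(i < m) (odd i && (5 <= i) : nat) = m %/ 2 - 2.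
Proof.
by elim: m => [|m IHm]; rewrite ?big_ord0 // big_ord_recr /= IHm; lia.
Qed.

Lemma sum_optval : \sum_v optval v = n %/ 2.
Proof.
rewrite /optval; case on: (odd n); last exact: sum_odd.
have n0 : 0 < n by lia.
pose z := Ordinal n0; have := sum_odd_ge5 n.
rewrite (bigD1 z) //= add0n => sE; rewrite (bigD1 z) //=.
rewrite (eq_bigr (fun i : 'I_n => odd i && (5 <= i) : nat)) ?sE; first by lia.
by move=> i; rewrite -val_eqE /= => /negPf->.
Qed.

Lemma optval_dist u v :
  u != v -> 0 < optval u -> 0 < optval v -> optval u < dist e u v.
Proof.
move=> uv; have uv' : u != v :> nat by rewrite val_eqE.
rewrite /optval; case: ifPn => on.
  have [u0|u0] := eqVneq (u : nat) 0.
    have [v0|v0] := eqVneq (v : nat) 0; first by lia.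
    (* D(0,v) = v is odd and at least 5, whereas one arc covers 1 or 3 and two arcs cover 2, 4 or 6,
       too little to wrap around. *)
    move=> _ v5; apply: dist_gt2 (connect13 u v) uv _ _.
      by rewrite eE; have := cycdiffP u v; lia.
    move=> w; rewrite !eE; have := cycdiffP u w; have := cycdiffP w v; lia.
  move=> u5 v5; have -> : odd u && (4 < u) = true by lia.
  (* The difference is even if v > u or v = 0; otherwise it is n + v - u >= 7, as u <= n - 2 and v
     >= 5. *)
  apply: dist_gt1 (connect13 u v) uv _.
  by rewrite eE; have := cycdiffP u v; case: eqVneq v5; lia.
move=> ou ov; have -> : odd u = true by lia.
apply: dist_gt1 (connect13 u v) uv _.
by rewrite eE; have := cycdiffP u v; lia.
Qed.

Lemma beta_b13 : beta_b e = n %/ 2.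
Proof.
apply/eqP; rewrite eqn_leq; apply/andP; split.
  by apply/bigmax_leqP => f; apply: cost13_le.
have opt2 v : optval v <= 2 by rewrite /optval; do !case: ifP; lia.
pose f : {ffun 'I_n -> 'I_(diam e).+1} := [ffun v => inord (optval v)].
(* [inord] would return 0 on a value above the diameter; 2 <= [ecc] <= [diam] excludes this. *)
have fE v : f v = optval v :> nat.
  rewrite ffunE inordK // ltnS; apply: leq_trans (opt2 v) _.
  exact: leq_trans (ecc13_ge2 v) (ecc_le_diam e v).
have indf : indep_broadcast f.
  apply/andP; split; apply/forallP=> u.
    by rewrite fE; apply: leq_trans (opt2 u) (ecc13_ge2 u).
  apply/forallP=> v; rewrite !fE; apply/implyP=> /and3P[]; exact: optval_dist.
rewrite /beta_b (bigD1 f) //=; apply: leq_trans (leq_maxl _ _).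
by rewrite /cost (eq_bigr _ (fun v _ => fE v)) sum_optval.
Qed.

End Circulant13.

(** Brings the integer congruence in [circulant] to the form of [eE], with [c] the representative of
    [b] in [0, n). *)
Lemma eqz_mod_cycdiff n (i j : 'I_n) (b : int) c :
  c < n -> (b = c%:Z %[mod n])%Z ->
  (j%:Z == (i%:Z + b)%R %[mod n])%Z = (cycdiff i j == c).
Proof.
move=> cn bc; rewrite -modzDmr bc modzDmr -PoszD !modz_nat eqz_nat.
rewrite (modn_small (ltn_ord j)); have ij := cycdiffP i j.
have [icn|icn] := ltnP (i + c) n; first by rewrite modn_small //; lia.
by rewrite -(subnK icn) modnDr modn_small; lia.
Qed.

Theorem theorem7 (n : nat) (hn : 4 <= n) :
  beta_b (circulant n [:: 1%Z; 3%Z]) =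
    beta_b (circulant n [:: 1%Z; (- (n%:Z - 3))%R]) /\
  beta_b (circulant n [:: 1%Z; (- (n%:Z - 3))%R]) = n %/ 2.
Proof.
have n3 : ((- (n%:Z - 3))%R = 3%:Z %[mod n])%Z.
  apply/eqP; rewrite -(eqz_modDr (n%:Z - 3)%R) GRing.addNr GRing.addrC.
  by rewrite GRing.subrK modzz mod0z.
rewrite !beta_b13 // => i j; rewrite /circulant /= orbF.
  by rewrite (@eqz_mod_cycdiff _ i j _ 1) ?(@eqz_mod_cycdiff _ i j _ 3) //; lia.
by rewrite (@eqz_mod_cycdiff _ i j _ 1) ?(@eqz_mod_cycdiff _ i j _ 3) //; lia.
Qed.
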